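(* Let $K = \mathbb{Q}[\sqrt{D}]$ be a real quadratic number field, where $D \in \mathbb{N}$ is square-free, and let $\alpha \in K$ with $\alpha > 0$ (under the real embedding of $K$). Then for every $\varepsilon > 0$ there is a constant $C = C(\alpha,\varepsilon)>0$ such that $\delta_{\min}^{(\alpha)}(N) \le C\, N^{-1+\varepsilon}$ for infinitely many $N$. Furthermore, if $\alpha \in \mathbb{Q}_{>0}\cdot (K^\times)^2$ (i.e. $\alpha = r\gamma^2$ with $r$ a positive rational and $\gamma \in K^\times$), then there is a constant $C = C(\alpha)>0$ such that $\delta_{\min}^{(\alpha)}(N) \le C\, N^{-1}$ for all $N$.
   Context: For a positive irrational real number $\alpha$, the numbers $\alpha m^2 + n^2$ with integers $m,n \ge 1$ (the eigenvalues of the Laplacian on a rectangular billiard with sides $\pi/\sqrt{\alpha}$ and $\pi$) are pairwise distinct, and we list them in increasing order as $0 < \lambda_1 < \lambda_2 < \cdots$. The minimal gap function is $\delta_{\min}^{(\alpha)}(N) = \min\{\lambda_{i+1} - \lambda_i : 1 \le i < N\}$. Here $\alpha \in K$ is assumed irrational implicitly via $\alpha$ being a quadratic irrationality; $K$ is regarded as a subfield of $\mathbb{R}$ via $\sqrt{D} > 0$. *)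

(* Defs.v *)
From mathcomp Require Import all_boot all_order all_algebra.
From mathcomp Require Import all_classical all_reals all_analysis.

Set Implicit Arguments.
Unset Strict Implicit.
Unset Printing Implicit Defensive.

Import Order.TTheory GRing.Theory Num.Theory.
Local Open Scope classical_set_scope.
Local Open Scope ring_scope.

Definition squarefree (D : nat) : Prop :=
  forall d : nat, (d ^ 2 %| D)%N -> d = 1%N.

(* The field Q[sqrt D], identified with its image in R under the embedding
   sending sqrt D to the positive square root. *)
Definition quad_field (R : realType) (D : nat) : set R :=
  [set x | exists p q : rat, x = ratr p + ratr q * Num.sqrt (D%:R : R)].

Definition billiard_spectrum (R : realType) (alpha : R) : set R :=
  [set x | exists m n : nat,
    [/\ (1 <= m)%N, (1 <= n)%N & x = alpha * m%:R ^+ 2 + n%:R ^+ 2]].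

(* Eigenvalues are indexed from 1; the value lam 0 is irrelevant. For irrational
   alpha every eigenvalue is simple, so listing the set without multiplicity
   loses nothing. *)
Definition enumerates_spectrum (R : realType) (alpha : R) (lam : nat -> R) :
    Prop :=
  (forall i : nat, (1 <= i)%N -> lam i < lam i.+1) /\
  lam @` [set i | (1 <= i)%N] = billiard_spectrum alpha.

(* The default value is the term of index 1, so for N >= 2 this is the minimum
   of a nonempty family; N <= 1 would be a minimum over the empty set. *)
Definition min_gap (R : realType) (lam : nat -> R) (N : nat) : R :=
  \big[Order.min/lam 2%N - lam 1%N]_(1 <= i < N) (lam i.+1 - lam i).

(* Main.v *)
(* A small difference alpha ab - cd of products of integers of size about M
   gives two eigenvalues of size O(M^2) at distance O(|alpha ab - cd|), so one
   needs rational approximations cd/(ab) of alpha that are nearly optimal and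
   whose numerator and denominator both split into factors of nearly equal
   size.  Write ' for conjugation in K = Q(s), s = sqrt D, and let z in Z[s]
   be such that z has size T and z' has size at most 1/T (Dirichlet).

   If alpha = r gamma^2, the integers (z^2 - z'^2)/4s and
   ((gamma z)^2 - (gamma z)'^2)/4s factor as differences of squares and
   r times the second divided by the first approximates alpha optimally.

   In general, take alpha = beta integral (up to a denominator), n odd and
   w = beta z^2.  Then beta (w^n - w'^n) - (beta w^n - beta' w'^n) is a multiple
   of w'^n, and beta w^n = (beta^((n+1)/2) z^n)^2 is a square, so
   beta w^n - beta' w'^n factors as a difference of squares.  For n = 105^j the
   polynomial X^n - 1 is X - 1 times two integral polynomials of equal degree:
   the cyclotomic degrees of the divisors d > 1 of 105 satisfy
   48 + 4 = 24 + 12 + 8 + 6 + 2, and one iterates X -> X^105.  The exponent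
   obtained is -n/(n+1), which tends to -1 with j. *)
Require Import Defs.
From mathcomp Require Import all_boot all_order all_algebra.
From mathcomp Require Import all_classical all_reals all_analysis.
From mathcomp Require Import zify ring lra.

Set Implicit Arguments.
Unset Strict Implicit.
Unset Printing Implicit Defensive.

Import Order.TTheory GRing.Theory Num.Theory.
Local Open Scope classical_set_scope.
Local Open Scope ring_scope.

(** * Irrationality and integer binary forms *)

Lemma int_ratio_not_irrational {R : realType} (x a b : R) :
  a \is a Num.int -> b \is a Num.int -> b != 0 -> x * b = a -> ~ irrational x.
Proof.
move=> /intrP[p ->] /intrP[q ->] q0 xE; apply; exists (p%:~R / q%:~R) => //.
rewrite rmorph_div/= ?ratr_int; last by move: q0; rewrite unitfE !intr_eq0.
by rewrite -xE mulfK.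
Qed.

(* The coefficient list starts at y^d, so that binary_form c x y is
   homogeneous of degree d = size c - 1. *)
Fixpoint binary_form {R : comNzRingType} (c : seq int) (x y : R) : R :=
  if c is a :: c' then a%:~R * y ^+ size c' + x * binary_form c' x y else 0.

(* Coefficients of the cyclotomic polynomials.  They are palindromic, so the
   forms are symmetric and take integer values on conjugate pairs. *)
Definition Phi3 : seq int :=
  [:: 1; 1; 1].

Definition Phi5 : seq int :=
  [:: 1; 1; 1; 1; 1].

Definition Phi7 : seq int :=
  [:: 1; 1; 1; 1; 1; 1; 1].

Definition Phi15 : seq int :=
  [:: 1; -1; 0; 1; -1; 1; 0; -1; 1].

Definition Phi21 : seq int :=
  [:: 1; -1; 0; 1; -1; 0; 1; 0; -1; 1; 0; -1; 1].

Definition Phi35 : seq int :=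
  [:: 1; -1; 0; 0; 0; 1; -1; 1; -1; 0; 1; -1; 1; -1; 1; 0; -1; 1; -1;
      1; 0; 0; 0; -1; 1].

Definition Phi105 : seq int :=
  [:: 1; 1; 1; 0; 0; -1; -1; -2; -1; -1; 0; 0; 1; 1; 1; 1; 1; 1; 0; 0;
      -1; 0; -1; 0; -1; 0; -1; 0; -1; 0; 0; 1; 1; 1; 1; 1; 1; 0; 0;
      -1; -1; -2; -1; -1; 0; 0; 1; 1; 1].

(** Since |y| <= |x|, every monomial of degree d is at most |x|^d, and the coefficients add up to a
    constant. *)
Lemma binary_form_bound {R : archiRealFieldType} (c : seq int) :
  exists2 C : R, 0 < C & forall x y : R, `|y| <= `|x| ->
    `|binary_form c x y| <= C * `|x| ^+ (size c).-1.
Proof.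
elim: c => [|a c [C C0 IH]].
  by exists 1 => // x y _ /=; rewrite normr0 expr0 mulr1.
exists (`|a%:~R| + C); first by rewrite ltr_wpDl.
move=> x y yx /=; rewrite mulrDl; apply: (le_trans (ler_normD _ _)).
apply: lerD; first by rewrite normrM normrX ler_wpM2l// lerXn2r ?nnegrE.
rewrite normrM; case: c IH => [|b c] IH; last first.
  by rewrite /= exprS mulrCA ler_wpM2l// IH.
by rewrite /= normr0 mulr0 mulr_ge0// ?exprn_ge0// ltW.
Qed.

(** * Conjugate pairs in Z[s] *)

(** Conjugation is no function on [R], so it is a relation: [x] and [y] are the values at s and -s
    of one polynomial a + b X with integer coefficients. *)
Definition conjugates {R : archiRealFieldType} (s x y : R) : Prop :=
  exists a b : R,
    [/\ a \is a Num.int, b \is a Num.int, x = a + b * s & y = a - b * s].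

Section Conjugates.
Context {R : archiRealFieldType} (s : R).
Hypothesis s2_int : s ^+ 2 \is a Num.int.

Lemma conjugates_int (a : R) : a \is a Num.int -> conjugates s a a.
Proof. by exists a, 0; split=> //; ring. Qed.

Lemma conjugatesC (x y : R) : conjugates s x y -> conjugates s y x.
Proof.
move=> [a [b [ai bi -> ->]]]; exists a, (- b).
by split; rewrite ?rpredN//; ring.
Qed.

Lemma conjugatesD (x y x' y' : R) :
  conjugates s x y -> conjugates s x' y' -> conjugates s (x + x') (y + y').
Proof.
move=> [a [b [ai bi -> ->]]] [c [d [ci di -> ->]]]; exists (a + c), (b + d).
by split; rewrite ?rpredD//; ring.
Qed.

Lemma conjugatesM (x y x' y' : R) :
  conjugates s x y -> conjugates s x' y' -> conjugates s (x * x') (y * y').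
Proof.
move=> [a [b [ai bi -> ->]]] [c [d [ci di -> ->]]].
exists (a * c + b * d * s ^+ 2), (a * d + b * c).
by split; rewrite ?(s2_int, rpredD, rpredM) //; ring.
Qed.

Lemma conjugatesX (x y : R) n :
  conjugates s x y -> conjugates s (x ^+ n) (y ^+ n).
Proof.
move=> xy; elim: n => [|n IH]; first by apply: conjugates_int; exact: rpred1.
by rewrite !exprS; exact: conjugatesM.
Qed.

Lemma conjugates_fixed_int (x : R) : conjugates s x x -> x \is a Num.int.
Proof.
move=> [a [b [ai _ xE xE']]].
have bs0 : b * s = 0 by lra.
by rewrite xE bs0 addr0.
Qed.

Lemma conjugates_form (c : seq int) (x y : R) : conjugates s x y ->
  conjugates s (binary_form c x y) (binary_form c y x).
Proof.
move=> xy; elim: c => [|a c IH] /=.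
  by apply: conjugates_int; exact: rpred0.
apply: conjugatesD; last exact: conjugatesM.
apply: conjugatesM; first exact/conjugates_int/intr_int.
exact/conjugatesX/conjugatesC.
Qed.

(** Swapping the arguments of a form conjugates its value, so a symmetric form has a value that is
    its own conjugate. *)
Lemma symmetric_form_int (c : seq int) (x y : R) :
  (forall u v : R, binary_form c u v = binary_form c v u) ->
  conjugates s x y -> binary_form c x y \is a Num.int.
Proof.
move=> c_sym xy; apply: conjugates_fixed_int.
by rewrite {2}c_sym; exact: conjugates_form.
Qed.

End Conjugates.

(** * Balanced splitting of x^n - y^n for n a power of 105 *)

(** Repeated use of Phi_d(X^q) = Phi_d(X) Phi_{dq}(X) for a prime q not dividing d. The grouping
    balances the degrees: 4 + 48 and 2 + 6 + 8 + 12 + 24 are both 52. *)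
Lemma Phi105M (R : comNzRingType) (x y : R) :
  x ^+ 105 - y ^+ 105 = (x - y) *
    ((binary_form Phi5 x y * binary_form Phi105 x y) *
     (binary_form Phi3 x y * binary_form Phi7 x y * binary_form Phi15 x y *
      binary_form Phi21 x y * binary_form Phi35 x y)).
Proof.
have -> : x ^+ 105 - y ^+ 105 =
    (x ^+ 35 - y ^+ 35) * binary_form Phi3 (x ^+ 35) (y ^+ 35).
  by rewrite /Phi3 /=; ring.
have -> : x ^+ 35 - y ^+ 35 =
    (x - y) * binary_form Phi5 x y * binary_form Phi7 (x ^+ 5) (y ^+ 5).
  by rewrite /Phi5 /Phi7 /=; ring.
have -> : binary_form Phi7 (x ^+ 5) (y ^+ 5) =
    binary_form Phi7 x y * binary_form Phi35 x y.
  by rewrite /Phi7 /Phi35 /=; ring.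
have -> : binary_form Phi3 (x ^+ 35) (y ^+ 35) =
    binary_form Phi3 (x ^+ 7) (y ^+ 7) * binary_form Phi15 (x ^+ 7) (y ^+ 7).
  by rewrite /Phi3 /Phi15 /=; ring.
have -> : binary_form Phi3 (x ^+ 7) (y ^+ 7) =
    binary_form Phi3 x y * binary_form Phi21 x y.
  by rewrite /Phi3 /Phi21 /=; ring.
have -> : binary_form Phi15 (x ^+ 7) (y ^+ 7) =
    binary_form Phi15 x y * binary_form Phi105 x y.
  by rewrite /Phi15 /Phi105 /=; ring.
by ring.
Qed.

Lemma balanced_splitting_105 {R : archiRealFieldType} :
  exists2 C : R, 1 <= C & forall s x y : R,
    s ^+ 2 \is a Num.int -> conjugates s x y -> `|y| <= `|x| ->
    exists a b : R, [/\ a \is a Num.int, b \is a Num.int,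
      x ^+ 105 - y ^+ 105 = (x - y) * (a * b),
      `|a| <= C * `|x| ^+ 52 & `|b| <= C * `|x| ^+ 52].
Proof.
have [C3 C3p B3] := binary_form_bound (R := R) Phi3.
have [C5 C5p B5] := binary_form_bound (R := R) Phi5.
have [C7 C7p B7] := binary_form_bound (R := R) Phi7.
have [C15 C15p B15] := binary_form_bound (R := R) Phi15.
have [C21 C21p B21] := binary_form_bound (R := R) Phi21.
have [C35 C35p B35] := binary_form_bound (R := R) Phi35.
have [C105 C105p B105] := binary_form_bound (R := R) Phi105.
pose Ca := C5 * C105; pose Cb := C3 * C7 * C15 * C21 * C35.
have Ca0 : 0 < Ca by rewrite !mulr_gt0.
have Cb0 : 0 < Cb by rewrite !mulr_gt0.
exists (1 + Ca + Cb); first by lra.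
move=> s x y s2 xy yx.
have xk k : 0 <= `|x| ^+ k by rewrite exprn_ge0.
have i3 : binary_form Phi3 x y \is a Num.int.
  by apply: (symmetric_form_int s2 _ xy) => u v; rewrite /Phi3 /=; ring.
have i5 : binary_form Phi5 x y \is a Num.int.
  by apply: (symmetric_form_int s2 _ xy) => u v; rewrite /Phi5 /=; ring.
have i7 : binary_form Phi7 x y \is a Num.int.
  by apply: (symmetric_form_int s2 _ xy) => u v; rewrite /Phi7 /=; ring.
have i15 : binary_form Phi15 x y \is a Num.int.
  by apply: (symmetric_form_int s2 _ xy) => u v; rewrite /Phi15 /=; ring.
have i21 : binary_form Phi21 x y \is a Num.int.
  by apply: (symmetric_form_int s2 _ xy) => u v; rewrite /Phi21 /=; ring.
have i35 : binary_form Phi35 x y \is a Num.int.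
  by apply: (symmetric_form_int s2 _ xy) => u v; rewrite /Phi35 /=; ring.
have i105 : binary_form Phi105 x y \is a Num.int.
  by apply: (symmetric_form_int s2 _ xy) => u v; rewrite /Phi105 /=; ring.
exists (binary_form Phi5 x y * binary_form Phi105 x y).
exists (binary_form Phi3 x y * binary_form Phi7 x y * binary_form Phi15 x y *
        binary_form Phi21 x y * binary_form Phi35 x y).
split.
- by rewrite rpredM ?i5 ?i105.
- by rewrite !rpredM ?i3 ?i7 ?i15 ?i21 ?i35.
- exact: Phi105M.
- apply: (@le_trans _ _ (Ca * `|x| ^+ 52)); last by rewrite ler_wpM2r//; lra.
  have -> : Ca * `|x| ^+ 52 = (C5 * `|x| ^+ 4) * (C105 * `|x| ^+ 48).
    by rewrite /Ca; ring.
  by rewrite normrM ler_pM// ?B5 ?B105.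
- apply: (@le_trans _ _ (Cb * `|x| ^+ 52)); last by rewrite ler_wpM2r//; lra.
  have -> : Cb * `|x| ^+ 52 = (C3 * `|x| ^+ 2) * (C7 * `|x| ^+ 6) *
      (C15 * `|x| ^+ 8) * (C21 * `|x| ^+ 12) * (C35 * `|x| ^+ 24).
    by rewrite /Cb; ring.
  rewrite !normrM.
  by do 4![apply: ler_pM; rewrite ?mulr_ge0// ?B3 ?B7 ?B15 ?B21 ?B35//].
Qed.

(** Induction on j with n = 2h + 1: splitting the conjugates x^n, y^n by the case 105 replaces n by
    105 n, that is h by 105 h + 52, and each cofactor gains degree 52 n. *)
Lemma balanced_splitting {R : archiRealFieldType} (j : nat) :
  exists (h : nat) (C : R), [/\ (j <= h)%N, 1 <= C & forall s x y : R,
    s ^+ 2 \is a Num.int -> conjugates s x y -> `|y| <= `|x| ->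
    exists a b : R, [/\ a \is a Num.int, b \is a Num.int,
      x ^+ h.*2.+1 - y ^+ h.*2.+1 = (x - y) * (a * b),
      `|a| <= C * `|x| ^+ h & `|b| <= C * `|x| ^+ h]].
Proof.
have deg52 h : (h * 105 + 52 = h + h.*2.+1 * 52)%N by lia.
have deg105 h : ((h * 105 + 52).*2.+1 = h.*2.+1 * 105)%N by lia.
have [C0 C01 split105] := balanced_splitting_105 (R := R).
elim: j => [|j [h [C [jh C1 IH]]]].
  exists 0%N, 1; split=> // s x y _ _ _; exists 1, 1.
  by split; rewrite ?expr0 ?expr1 ?normr1 ?mulr1.
exists (h * 105 + 52)%N, (C * C0); split; [lia| |].
  by rewrite -[1]mulr1 ler_pM.
move=> s x y s2 xy yx.
have [a [b [ai bi abE ha hb]]] := IH s x y s2 xy yx.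
have yxn : `|y ^+ h.*2.+1| <= `|x ^+ h.*2.+1|.
  by rewrite !normrX lerXn2r ?nnegrE.
have [c [d [ci di cdE hc hd]]] :=
  split105 s _ _ s2 (conjugatesX s2 h.*2.+1 xy) yxn.
exists (a * c), (b * d).
have degE (u : R) : u ^+ (h * 105 + 52) = u ^+ h * (u ^+ h.*2.+1) ^+ 52.
  by rewrite deg52 exprD exprM.
rewrite normrX in hc hd.
split; rewrite ?rpredM//.
- have expE (u : R) : u ^+ (h * 105 + 52).*2.+1 = (u ^+ h.*2.+1) ^+ 105.
    by rewrite deg105 exprM.
  by rewrite !expE cdE abE; ring.
- by rewrite normrM degE mulrACA ler_pM.
- by rewrite normrM degE mulrACA ler_pM.
Qed.

(** * From factored approximations to small gaps *)

Section Spectrum.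
Context {R : realType}.
Implicit Types (alpha : R) (lam : nat -> R).

(* Since 8ab = (2a+b)^2 - (2a-b)^2 = (a+2b)^2 - (a-2b)^2, one of the two
   representations uses nonzero squares only. *)
Lemma int_mul8_sub_squares (a b M : R) :
  a \is a Num.int -> b \is a Num.int -> a != 0 -> b != 0 ->
  `|a| <= M -> `|b| <= M ->
  exists m n : nat, [/\ (1 <= m)%N, (1 <= n)%N, m%:R <= 3 * M, n%:R <= 3 * M &
    m%:R ^+ 2 - n%:R ^+ 2 = 8 * (a * b) :> R].
Proof.
suff key (u v : R) : u \is a Num.int -> v \is a Num.int ->
    u + v != 0 -> u - v != 0 -> `|u| + `|v| <= 3 * M ->
    exists m n : nat, [/\ (1 <= m)%N, (1 <= n)%N, m%:R <= 3 * M, n%:R <= 3 * M &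
      m%:R ^+ 2 - n%:R ^+ 2 = 4 * (u * v) :> R].
  move=> ai bi a0 b0 aM bM.
  have i2 : (2 : R) \is a Num.int by exact: (natr_int R 2).
  have n2 (x : R) : `|2 * x| = 2 * `|x| by rewrite normrM ger0_norm.
  have [ab|ab] := boolP ((2 * a + b != 0) && (2 * a - b != 0)).
    case/andP: ab => ab1 ab2.
    have [||m [n [m1 n1 mM nM E]]] := key (2 * a) b _ bi ab1 ab2.
    - by rewrite rpredM.
    - by rewrite n2; lra.
    by exists m, n; split=> //; rewrite E; ring.
  have [||||m [n [m1 n1 mM nM E]]] := key a (2 * b) ai.
  - by rewrite rpredM.
  (* If a = -2b, then 2a + b = -3b and 2a - b = -5b are nonzero and the first representation would
     have worked; a = 2b is excluded in the same way. *)
  - apply: contra ab => /eqP ab; apply/andP; split;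
      apply: contra b0 => /eqP ab';
      by apply/eqP; lra.
  - apply: contra ab => /eqP ab; apply/andP; split;
      apply: contra b0 => /eqP ab';
      by apply/eqP; lra.
  - by rewrite n2; lra.
  by exists m, n; split=> //; rewrite E; ring.
move=> ui vi uv0 uv0' uvM.
have /natrP[m mE] : `|u + v| \is a Num.nat by rewrite natr_norm_int// rpredD.
have /natrP[n nE] : `|u - v| \is a Num.nat by rewrite natr_norm_int// rpredB.
exists m, n; split.
- by rewrite -(ltr_nat R) -mE normr_gt0.
- by rewrite -(ltr_nat R) -nE normr_gt0.
- by rewrite -mE (le_trans (ler_normD _ _)).
- by rewrite -nE (le_trans (ler_normB _ _)).
- by rewrite -mE -nE !real_normK ?num_real//; ring.
Qed.

Lemma lam_nondecreasing lam i j : (forall k, (1 <= k)%N -> lam k < lam k.+1) ->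
  (1 <= i)%N -> (i <= j)%N -> lam i <= lam j.
Proof.
move=> lam_inc i1; elim: j => [|j IH]; first by lia.
rewrite leq_eqVlt => /predU1P[->//|]; rewrite ltnS => ij.
by rewrite (le_trans (IH ij))// ltW// lam_inc// (leq_trans i1).
Qed.

(** The gap starting at index i enters the minimum, and it is at most [lam j - lam i] by
    monotonicity. *)
Lemma min_gap_le_sub lam i j N :
  (forall k, (1 <= k)%N -> lam k < lam k.+1) ->
  (1 <= i)%N -> (i < j)%N -> (i < N)%N -> min_gap lam N <= lam j - lam i.
Proof.
move=> lam_inc i1 ij iN; apply: (@bigmin_inf_seq _ _ _ _ _ i) => //.
  by rewrite mem_index_iota i1 iN.
by rewrite lerD2r lam_nondecreasing.
Qed.

(** Pigeonhole: the distinct values [lam 1], ..., [lam j] come from distinct pairs (m, n) in a box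
    of (L + 1)^2 points. *)
Lemma enum_index_le alpha lam (j L : nat) : enumerates_spectrum alpha lam ->
  (forall m n : nat, alpha * m%:R ^+ 2 + n%:R ^+ 2 <= lam j ->
     (m <= L)%N /\ (n <= L)%N) ->
  (j <= L.+1 ^ 2)%N.
Proof.
move=> [lam_inc lamE] box.
have spec (k : 'I_j) : exists p : 'I_L.+1 * 'I_L.+1,
    lam k.+1 = alpha * (p.1 : nat)%:R ^+ 2 + (p.2 : nat)%:R ^+ 2.
  have : billiard_spectrum alpha (lam k.+1) by rewrite -lamE; exists k.+1.
  move=> [m [n [_ _ E]]].
  have [mL nL] : (m <= L)%N /\ (n <= L)%N.
    by apply: box; rewrite -E; apply: lam_nondecreasing.
  exists (inord m, inord n) => /=.
  by rewrite !inordK.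
have [f fE] := choice spec.
have lt_lam k l : (k < l)%N -> lam k.+1 < lam l.+1.
  move=> kl; apply: (lt_le_trans (lam_inc k.+1 _)) => //.
  exact: lam_nondecreasing.
have f_inj : injective f.
  move=> k l kl; apply: val_inj => /=.
  have lamkl : lam k.+1 = lam l.+1 by rewrite !fE kl.
  by case: (ltngtP k l) => // /lt_lam; rewrite lamkl ltxx.
by have := leq_card f f_inj; rewrite card_prod !card_ord.
Qed.

(** Write 8ab = m1^2 - m2^2 and 8cd = n1^2 - n2^2. The eigenvalues alpha m1^2 + n2^2 and alpha m2^2
    + n1^2 differ by 8 (alpha ab - cd), and both are O(M^2), so their indices are O(M^2) too. *)
Lemma min_gap_le_of_factored_approx alpha lam :
  0 < alpha -> irrational alpha -> enumerates_spectrum alpha lam ->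
  exists2 K : R, 0 < K & forall M a b c d delta (N : nat),
    1 <= M ->
    [/\ a \is a Num.int, b \is a Num.int, c \is a Num.int & d \is a Num.int] ->
    a * b != 0 -> c * d != 0 ->
    [/\ `|a| <= M, `|b| <= M, `|c| <= M & `|d| <= M] ->
    `|alpha * (a * b) - c * d| <= delta -> K * M ^+ 2 <= N%:R ->
    min_gap lam N <= 8 * delta.
Proof.
move=> alpha0 alpha_irr lamE; have [lam_inc lam_im] := lamE.
(* If alpha m^2 + n^2 <= (alpha + 1) (3M)^2, then m <= 3 theta M and n <= 3 (alpha + 1) M, as both
   factors are at least 1 and so dominate their square roots; kap M bounds m and n at once. *)
pose theta := 1 + alpha^-1; pose kap := 3 * (theta + (alpha + 1)).
have ainv : 0 < alpha^-1 by rewrite invr_gt0.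
have kap1 : 1 <= kap by rewrite /kap /theta; lra.
exists (4 * kap ^+ 2); first by rewrite mulr_gt0// exprn_gt0//; lra.
move=> M a b c d delta N M1 [ai bi ci di].
rewrite !mulf_eq0 !negb_or => /andP[a0 b0] /andP[c0 d0] [aM bM cM dM] abcd NK.
have [m1 [m2 [m1_1 m2_1 m1M m2M mE]]] := int_mul8_sub_squares ai bi a0 b0 aM bM.
have [n1 [n2 [n1_1 n2_1 n1M n2M nE]]] := int_mul8_sub_squares ci di c0 d0 cM dM.
have mem_spec (m n : nat) : (1 <= m)%N -> (1 <= n)%N ->
    exists2 i, (1 <= i)%N & lam i = alpha * m%:R ^+ 2 + n%:R ^+ 2.
  move=> hm hn; have : billiard_spectrum alpha (alpha * m%:R ^+ 2 + n%:R ^+ 2).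
    by exists m, n.
  by rewrite -lam_im => -[i i1 <-]; exists i.
have index_lt (i m n : nat) : (1 <= i)%N -> m%:R <= 3 * M -> n%:R <= 3 * M ->
    lam i = alpha * m%:R ^+ 2 + n%:R ^+ 2 -> (i <= N)%N.
  move=> i1 mM nM lamiE.
  have lami : lam i <= (alpha + 1) * (3 * M) ^+ 2.
    rewrite lamiE mulrDl mul1r; apply: lerD; first apply: ler_wpM2l.
    - exact: ltW.
    - by rewrite lerXn2r ?nnegrE//; lra.
    - by rewrite lerXn2r ?nnegrE//; lra.
  (* Both coordinates are at most L, so i <= (L + 1)^2 <= (2 kap M)^2, which is the bound imposed on
     N. *)
  pose L := Num.truncn (kap * M).
  have kM1 : 1 <= kap * M by rewrite -[1]mulr1 ler_pM.
  have kM0 : 0 <= kap * M by lra.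
  have kapE : kap * M = theta * (3 * M) + (alpha + 1) * (3 * M).
    by rewrite /kap; ring.
  have th1 : 1 <= theta by rewrite /theta; lra.
  have iL : (i <= L.+1 ^ 2)%N.
    apply: enum_index_le lamE _ => m' n' /le_trans /(_ lami) le_box.
    have m'0 : 0 <= m'%:R ^+ 2 :> R by rewrite sqr_ge0.
    have n'0 : 0 <= n'%:R ^+ 2 :> R by rewrite sqr_ge0.
    have am'0 : 0 <= alpha * m'%:R ^+ 2 by rewrite mulr_ge0// ltW.
    have sq3 : 0 <= (3 * M) ^+ 2 by rewrite sqr_ge0.
    have M0 : 0 <= M by lra.
    have M3 : 0 <= 3 * M by lra.
    have th0 : 0 <= theta by lra.
    have al0 : 0 <= alpha + 1 by lra.
    split; rewrite truncn_ge_nat//.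
      apply: (@le_trans _ _ (theta * (3 * M))); last first.
        by rewrite kapE lerDl mulr_ge0//; lra.
      rewrite -ler_sqr ?nnegrE ?mulr_ge0//.
      have : m'%:R ^+ 2 <= theta * (3 * M) ^+ 2.
        rewrite -(ler_pM2l alpha0) (_ : alpha * (theta * _) =
          (alpha + 1) * (3 * M) ^+ 2); first by lra.
        by rewrite /theta; field; rewrite gt_eqF.
      move=> /le_trans; apply; rewrite [leRHS]exprMn ler_wpM2r//.
      by rewrite expr2 -[leLHS]mulr1 ler_wpM2l//; lra.
    apply: (@le_trans _ _ ((alpha + 1) * (3 * M))); last first.
      by rewrite kapE lerDr mulr_ge0//; lra.
    rewrite -ler_sqr ?nnegrE ?mulr_ge0//.
    apply: (@le_trans _ _ ((alpha + 1) * (3 * M) ^+ 2)); first by lra.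
    rewrite [leRHS]exprMn ler_wpM2r//.
    by rewrite expr2 -[leLHS]mulr1 ler_wpM2l//; lra.
  rewrite -(ler_nat R); apply: le_trans NK.
  apply: le_trans (_ : (L.+1 ^ 2)%:R <= _).
    by rewrite ler_nat.
  have LkM : L.+1%:R <= 2 * (kap * M).
    have /andP[LE _] := truncn_itv kM0.
    by rewrite -natr1 /L; lra.
  rewrite natrX (_ : 4 * _ * _ = (2 * (kap * M)) ^+ 2); last by ring.
  by rewrite lerXn2r ?nnegrE//; lra.
have [i i1 iE] := mem_spec m1 n2 m1_1 n2_1.
have [j j1 jE] := mem_spec m2 n1 m2_1 n1_1.
have iN := index_lt _ _ _ i1 m1M n2M iE.
have jN := index_lt _ _ _ j1 m2M n1M jE.
have diffE : lam i - lam j = 8 * (alpha * (a * b) - c * d).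
  have -> : 8 * (alpha * (a * b) - c * d) =
      alpha * (8 * (a * b)) - 8 * (c * d) by ring.
  by rewrite -mE -nE iE jE; ring.
have absdiff : `|lam i - lam j| <= 8 * delta.
  by rewrite diffE normrM ger0_norm// ler_wpM2l.
case: (ltngtP i j) => ij.
- apply: le_trans absdiff; rewrite distrC; apply: le_trans (ler_norm _).
  by apply: min_gap_le_sub => //; apply: leq_trans jN.
- apply: le_trans absdiff; apply: le_trans (ler_norm _).
  by apply: min_gap_le_sub => //; apply: leq_trans iN.
(* Equal indices would make alpha = cd / (ab) rational. *)
- have E : alpha * (a * b) = c * d by have := diffE; rewrite ij subrr; lra.
  have ab0 : a * b != 0 by rewrite mulf_neq0.
  have [abi cdi] : a * b \is a Num.int /\ c * d \is a Num.int.
    by split; rewrite rpredM.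
  by have := int_ratio_not_irrational cdi abi ab0 E alpha_irr.
Qed.


End Spectrum.

(** * Dirichlet approximation and elements with small conjugate *)

Section Approximation.
Context {R : realType}.

(** Pigeonhole: the Q + 1 fractional parts of 0, x, ..., Qx lie in Q intervals of length 1/Q; two
    indices i < j sharing an interval give v = j - i. *)
Lemma dirichlet_approx (x : R) (Q : nat) : (1 <= Q)%N ->
  exists u v : R, [/\ u \is a Num.int, v \is a Num.int,
    1 <= v <= Q%:R & `|u - v * x| <= Q%:R^-1].
Proof.
case: Q => // Q _.
have Q0 : 0 < Q.+1%:R :> R by rewrite ltr0n.
pose fr (i : nat) := i%:R * x - (Num.floor (i%:R * x))%:~R.
have fr_itv i : 0 <= fr i < 1.
  by have := floor_itv (i%:R * x); rewrite /fr intrD; lra.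
have Qfr i : 0 <= Q.+1%:R * fr i.
  by have /andP[? _] := fr_itv i; rewrite mulr_ge0.
pose f (i : 'I_Q.+2) : 'I_Q.+1 := inord (Num.truncn (Q.+1%:R * fr i)).
have fE i : f i = Num.truncn (Q.+1%:R * fr i) :> nat.
  rewrite inordK// ltnS truncn_le_nat -[ltRHS]mulr1 ltr_pM2l//.
  by have /andP[] := fr_itv i.
have /injectivePn[i [j]] : ~~ injectiveb f.
  by apply/injectiveP => /leq_card; rewrite !card_ord ltnn.
wlog ij : i j / (i < j)%N => [wl|_ fij].
  case: (ltngtP i j) => [ij|ij|/val_inj-> /eqP//] neq fij.
    exact: (wl i j).
  by apply: (wl j i) => //; rewrite eq_sym.
have ij1 : (i%:R + 1 <= j%:R :> R) by rewrite natr1 ler_nat.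
have jQ : j%:R <= Q.+1%:R :> R by rewrite ler_nat -ltnS.
exists (Num.floor (j%:R * x) - Num.floor (i%:R * x))%:~R, (j%:R - i%:R).
split; [exact: intr_int| by rewrite rpredB ?natr_int | |].
  by have := ler0n R i; lra.
have -> : (Num.floor (j%:R * x) - Num.floor (i%:R * x))%:~R - (j%:R - i%:R) * x
    = fr i - fr j by rewrite /fr intrB; ring.
rewrite -[leRHS]mulr1 -ler_pdivrMl ?invr_gt0// invrK.
rewrite -[X in X * _]gtr0_norm// -normrM mulrBr.
have /andP[li gi] := truncn_itv (Qfr i).
have /andP[lj gj] := truncn_itv (Qfr j).
move: li gi; rewrite -fE fij fE => li gi; rewrite -[ltRHS]natr1 in gi gj.
by rewrite ler_norml; lra.
Qed.

(* The product of the two conjugates is a nonzero integer, so the first one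
   cannot be much larger than T when the second one is at most 1/T. *)
Lemma small_conjugate (s : R) : 0 < s -> s ^+ 2 \is a Num.int ->
  irrational s ->
  exists2 C : R, 1 <= C & forall T : nat, (1 <= T)%N ->
    exists z z' : R, [/\ conjugates s z z', `|z'| <= T%:R^-1,
      T%:R <= `|z| & `|z| <= C * T%:R].
Proof.
move=> s_gt0 s2_int s_irr; exists (1 + 2 * s) => [|T T1]; first by lra.
have T1R : 1 <= T%:R :> R by rewrite (ler_nat R 1).
have T0R : 0 < T%:R :> R by lra.
have [u [v [ui vi /andP[v1 vT] uvT]]] := dirichlet_approx s T1.
exists (u + v * s), (u - v * s); split=> //; first by exists u, v.
- have normE : (u + v * s) * (u - v * s) = u ^+ 2 - v ^+ 2 * s ^+ 2 by ring.
  (* The norm is a nonzero integer, so |z| >= 1/|z'| >= T: this is the lower bound on z. *)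
  have norm_ge1 : 1 <= `|(u + v * s) * (u - v * s)|.
    apply: norm_intr_ge1.
      by rewrite normE !(s2_int, rpredB, rpredM, rpredX).
    have v0 : v != 0 by rewrite gt_eqF//; lra.
    rewrite mulf_eq0; apply/norP; split; apply/eqP => uv0.
      by apply: (@int_ratio_not_irrational _ s (- u) v _ vi v0) s_irr;
        rewrite ?rpredN//; lra.
    by apply: (int_ratio_not_irrational ui vi v0) s_irr; lra.
  rewrite -[leLHS]mul1r -ler_pdivlMr//; apply: le_trans norm_ge1 _.
  by rewrite normrM ler_wpM2l.
(* The upper bound uses z = z' + 2vs with v <= T. *)
- have -> : u + v * s = (u - v * s) + v * (2 * s) by ring.
  apply: (le_trans (ler_normD _ _)); rewrite [leRHS]mulrDl mul1r; apply: lerD.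
    by apply: (le_trans uvT); apply: (@le_trans _ _ 1); rewrite // invf_le1.
  rewrite ger0_norm ?mulr_ge0//; [|lra|lra].
  by rewrite mulrC ler_wpM2l//; lra.
Qed.

(** Here a = (x + y)/2 and b = (x - y)/(2s), so the difference of squares x^2 - y^2 is 4s times a
    product of two integers of size O(|x|). *)
Lemma conjugates_coords (s x y : R) :
  0 < s -> conjugates s x y -> `|y| < `|x| ->
  exists a b : R, [/\ a \is a Num.int, b \is a Num.int,
    4 * s * (a * b) = x ^+ 2 - y ^+ 2, 2 * s * b = x - y &
    [/\ a * b != 0, `|a| <= (1 + s^-1) * `|x| & `|b| <= (1 + s^-1) * `|x|]].
Proof.
move=> s_gt0 [a [b [ai bi xE yE]]] yx; exists a, b.
have sV : 0 < s^-1 by rewrite invr_gt0.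
have x0 : 0 <= `|x| by [].
have abE : 4 * s * (a * b) = x ^+ 2 - y ^+ 2 by rewrite xE yE; ring.
have bE : 2 * s * b = x - y by rewrite xE yE; ring.
do 2!split=> //.
- apply: contraTneq yx => ab0; rewrite -leNgt -ler_sqr ?nnegrE//.
  by rewrite !real_normK ?num_real//; move: abE; rewrite ab0; lra.
- have : `|2 * a| <= `|x| + `|y|.
    by rewrite (_ : 2 * a = x + y) ?ler_normD// xE yE; ring.
  rewrite normrM (ger0_norm (_ : 0 <= 2)) ?ler0n// mulrDl mul1r => h.
  by have : 0 <= s^-1 * `|x|; [rewrite mulr_ge0// ltW|lra].
- have : `|2 * s * b| <= `|x| + `|y| by rewrite bE ler_normB.
  rewrite normrM ger0_norm; last by rewrite mulr_ge0// ltW.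
  move=> h; have hb : `|b| <= s^-1 * `|x|.
    by rewrite -ler_pdivrMl ?invr_gt0// invrK; lra.
  by rewrite mulrDl mul1r; lra.
Qed.

End Approximation.

(** * From approximations at all scales to a power of N *)

(** At scale T the eigenvalues will have size T^(2e) and the gap size T^(-f), whence the exponent
    -f/(2e). *)
Definition factored_approx {R : realType} (alpha C : R) (e f T : nat) : Prop :=
  exists a b c d : R,
    [/\ [/\ a \is a Num.int, b \is a Num.int,
            c \is a Num.int & d \is a Num.int],
        a * b != 0, c * d != 0,
        [/\ `|a| <= C * T%:R ^+ e, `|b| <= C * T%:R ^+ e,
            `|c| <= C * T%:R ^+ e & `|d| <= C * T%:R ^+ e] &
        `|alpha * (a * b) - c * d| <= C * T%:R ^- f].

Lemma min_gap_powR {R : realType} (alpha C : R) (lam : nat -> R)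
    (e f T0 : nat) :
  0 < alpha -> irrational alpha -> enumerates_spectrum alpha lam ->
  (0 < e)%N -> 1 <= C ->
  (forall T, (T0 <= T)%N -> (1 <= T)%N -> factored_approx alpha C e f T) ->
  exists C' : R, 0 < C' /\ forall N : nat, (2 <= N)%N ->
    min_gap lam N <= C' * N%:R `^ (- (f%:R / e.*2%:R)).
Proof.
move=> alpha0 alpha_irr lamE e0 C1 approx; have [lam_inc _] := lamE.
have [K K0 gapK] := min_gap_le_of_factored_approx alpha0 alpha_irr lamE.
pose K1 := K * C ^+ 2; have K10 : 0 < K1 by rewrite mulr_gt0// exprn_gt0//; lra.
pose g := lam 2%N - lam 1%N; have g0 : 0 < g by rewrite subr_gt0 lam_inc.
pose rho : R := - (f%:R / e.*2%:R).
have e2 : e.*2%:R != 0 :> R by rewrite pnatr_eq0 double_eq0 -lt0n.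
(* [A] absorbs the small N, whose scale T is at most [T0], through the trivial bound by the first
   gap; [B] serves the others, with 2^f because tau <= 2T. *)
pose A := g * T0.+1.+1%:R ^+ f; pose B := 8 * C * 2 ^+ f.
have A0 : 0 < A by rewrite mulr_gt0// exprn_gt0// ltr0n.
have B0 : 0 < B by rewrite !mulr_gt0 ?exprn_gt0//; lra.
have K1V0 : 0 < K1^-1 by rewrite invr_gt0.
exists ((A + B) * K1^-1 `^ rho); split.
  by rewrite mulr_gt0// ?powR_gt0 ?invr_gt0//; lra.
move=> N N2; have N0 : 0 < N%:R :> R by rewrite ltr0n (ltn_trans _ N2).
(* The scale is T = floor(tau), where tau solves K (C tau^e)^2 = N. *)
pose tau : R := (N%:R / K1) `^ (e.*2%:R^-1).
have NK0 : 0 < N%:R / K1 by rewrite divr_gt0.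
have tau0 : 0 < tau by rewrite powR_gt0.
have tau_e : tau ^+ e.*2 = N%:R / K1.
  by rewrite -powR_mulrn ?ltW// -powRrM mulVf// powRr1// ltW.
have tau_f : tau ^- f = N%:R `^ rho * K1^-1 `^ rho.
  rewrite -powR_invn ?ltW// -powRrM -powRM ?ltW//.
  by congr (_ `^ _); rewrite /rho mulrN mulrC.
suff : min_gap lam N <= (A + B) * tau ^- f.
  by rewrite tau_f mulrA mulrAC.
have tauV : 0 < tau ^- f by rewrite invr_gt0 exprn_gt0.
pose T := Num.truncn tau.
have /andP[T_le T_gt] := truncn_itv (ltW tau0).
rewrite -/T -[ltRHS]natr1 in T_le T_gt.
have [TT0|TT0] := leqP T0.+1 T; last first.
  have tau_lt : tau <= T0.+1.+1%:R.
    apply: ltW; apply: (lt_le_trans T_gt); by rewrite natr1 ler_nat leqW.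
  apply: (@le_trans _ _ g); first exact: bigmin_le_id.
  apply: (@le_trans _ _ (A * tau ^- f)); last by rewrite ler_wpM2r//; lra.
  rewrite -mulrA -[leLHS]mulr1 ler_wpM2l ?(ltW g0)// ler_pdivlMr ?exprn_gt0//.
  by rewrite mul1r lerXn2r ?nnegrE ?(ltW tau0).
have T1 : (1 <= T)%N by exact: leq_ltn_trans TT0.
have T1R : 1 <= T%:R :> R by rewrite (ler_nat R 1).
have [a [b [c [d [abcdi ab0 cd0 abcdM approxT]]]]] := approx T (ltnW TT0) T1.
have Te : 1 <= T%:R ^+ e :> R by rewrite exprn_ege1.
have gapT : min_gap lam N <= 8 * (C * T%:R ^- f).
  apply: (gapK (C * T%:R ^+ e) a b c d) => //.
    by rewrite -[leLHS]mulr1 ler_pM.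
  rewrite exprMn -exprM mulrA -/K1 muln2 mulrC -ler_pdivlMr// -tau_e.
  by rewrite lerXn2r ?nnegrE ?ler0n// ltW.
apply: (le_trans gapT); apply: (@le_trans _ _ (B * tau ^- f)); last first.
  by rewrite ler_wpM2r//; lra.
rewrite /B -!mulrA !ler_wpM2l//; first by lra.
have Tf : 0 < T%:R ^+ f :> R by rewrite exprn_gt0//; lra.
rewrite -[leLHS]mul1r ler_pdivrMr// mulrAC ler_pdivlMr ?exprn_gt0// mul1r.
by rewrite -exprMn lerXn2r ?nnegrE ?mulr_ge0 ?ltW//; lra.
Qed.

(** * Clearing denominators and choosing thresholds *)

Lemma ratr_numq_denq {R : realType} (r : rat) :
  ratr r * (denq r)%:~R = (numq r)%:~R :> R.
Proof. by rewrite /ratr mulfVK// intr_eq0 denq_neq0. Qed.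

Lemma quad_field_conjugates {R : realType} (D : nat) (x : R) :
  quad_field D x -> exists k y : R,
    [/\ k \is a Num.int, 0 < k & conjugates (Num.sqrt D%:R) (k * x) y].
Proof.
move=> [p [q ->]]; set s := Num.sqrt _.
exists ((denq p)%:~R * (denq q)%:~R).
exists ((numq p)%:~R * (denq q)%:~R - (numq q)%:~R * (denq p)%:~R * s).
split; rewrite ?rpredM ?intr_int ?mulr_gt0 ?ltr0z ?denq_gt0//.
exists ((numq p)%:~R * (denq q)%:~R), ((numq q)%:~R * (denq p)%:~R).
split; rewrite ?rpredM ?intr_int//.
by rewrite -!ratr_numq_denq; ring.
Qed.

Lemma sqrt_irrational_of_quad_field {R : realType} (D : nat) (x : R) :
  quad_field D x -> irrational x -> irrational (Num.sqrt D%:R : R).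
Proof.
move=> [p [q ->]] + [t _ tE]; apply; exists (p + q * t) => //.
by rewrite rmorphD rmorphM/= tE.
Qed.

Lemma exists_nat_dominating {R : realType} (x y : R) : 0 < x ->
  exists T0 : nat, (2 <= T0)%N /\
    forall T, (T0 <= T)%N -> y < x * T%:R.
Proof.
move=> x0; exists (Num.truncn (y / x)).+2; split=> // T TT0.
rewrite mulrC -ltr_pdivrMr//; apply: (lt_le_trans (truncnS_gt _)).
by rewrite ler_nat ltnW.
Qed.

(** * The two constructions of factored approximations *)

(** With 4s uv = z^2 - z'^2 and 4s gh = (Gz)^2 - (G'z')^2, the terms in z^2 cancel in alpha m uv - r
    gh. What remains is a multiple of z'^2, hence O(T^-2), while all factors are O(T). *)
Lemma square_class_factored_approx {R : realType} (s alpha m r G G' : R) :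
  0 < s -> s ^+ 2 \is a Num.int -> irrational s ->
  m \is a Num.int -> r \is a Num.int -> m != 0 -> r != 0 -> G != 0 ->
  conjugates s G G' -> alpha * m = r * G ^+ 2 ->
  exists (C : R) (T0 : nat), 1 <= C /\
    forall T, (T0 <= T)%N -> (1 <= T)%N -> factored_approx alpha C 1 2 T.
Proof.
move=> s0 s2 s_irr mi ri m0 r0 G0 GG' alphaE.
have [C0 C01 small] := small_conjugate s0 s2 s_irr.
have Gn0 : 0 < `|G| by rewrite normr_gt0.
have [T0 [T02 domT]] := exists_nat_dominating `|G'| Gn0.
pose c1 := 1 + s^-1; have c11 : 1 <= c1 by rewrite lerDl invr_ge0 ltW.
pose Cs := (1 + `|m| + `|r|) * (1 + `|G|) * (c1 * C0).
pose Cd := `|r * (G' ^+ 2 - G ^+ 2)| / (4 * s).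
have s4 : 0 < 4 * s by lra.
have Cd0 : 0 <= Cd by rewrite divr_ge0// ltW.
have c1C0 : 1 <= c1 * C0 by rewrite -[leLHS]mulr1 ler_pM.
have Cs1 : 1 <= Cs.
  rewrite -[leLHS]mulr1 /Cs ler_pM// -[leLHS]mulr1 ler_pM//.
    by rewrite -addrA lerDl addr_ge0.
  by rewrite lerDl.
exists (Cs + Cd), T0; split=> [|T TT0 T1]; first by lra.
have T2 : 2 <= T%:R :> R by rewrite (ler_nat R 2) (leq_trans T02).
have [z [z' [zz' z'T Tz zT]]] := small T T1.
have TV1 : T%:R^-1 < 1 :> R by rewrite invf_lt1; lra.
have z'z : `|z'| < `|z| by lra.
(* The threshold [T0] ensures this domination, which makes gh nonzero. *)
have GzG'z' : `|G' * z'| < `|G * z|.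
  rewrite !normrM; apply: (@le_lt_trans _ _ (`|G'| * T%:R^-1)).
    by rewrite ler_wpM2l.
  rewrite ltr_pdivrMr; last by lra.
  apply: (lt_le_trans (domT T TT0)); rewrite ler_wpM2r//.
  by rewrite ler_peMr//; lra.
have [u [v [ui vi uvE _ [uv0 uz vz]]]] := conjugates_coords s0 zz' z'z.
have [g [h [gi hi ghE _ [gh0 gz hz]]]] :=
  conjugates_coords s0 (conjugatesM s2 GG' zz') GzG'z'.
rewrite -/c1 in uz vz gz hz.
have small_coord (x X t : R) : 0 <= x -> x <= 1 + `|m| + `|r| ->
    0 <= X -> X <= 1 + `|G| -> `|t| <= c1 * (X * `|z|) ->
    x * `|t| <= (Cs + Cd) * T%:R ^+ 1.
  move=> x0 xle X0 Xle tle; apply: (@le_trans _ _ (Cs * T%:R)); last first.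
    by rewrite expr1 ler_wpM2r//; lra.
  rewrite /Cs -!mulrA ler_pM//; apply: (le_trans tle).
  rewrite [leRHS]mulrCA ler_wpM2l//; first by lra.
  by rewrite ler_pM.
exists (m * u), v, (r * g), h; split.
- by rewrite !rpredM.
- by rewrite -mulrA mulf_neq0.
- by rewrite -mulrA mulf_neq0.
- split.
  + rewrite normrM; apply: (small_coord _ 1) => //; rewrite ?mul1r//.
      by have := normr_ge0 r; lra.
    by rewrite lerDl.
  + rewrite -[`|v|]mul1r; apply: (small_coord _ 1) => //; rewrite ?mul1r//.
      by rewrite -addrA lerDl addr_ge0.
    by rewrite lerDl.
  + rewrite normrM; apply: (small_coord _ `|G|) => //; last by rewrite -normrM.
      by have := normr_ge0 m; lra.
    by rewrite lerDr.
  + rewrite -[`|h|]mul1r; apply: (small_coord _ `|G|) => //;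
      last by rewrite -normrM.
      by rewrite -addrA lerDl addr_ge0.
    by rewrite lerDr.
- have diffE : 4 * s * (alpha * (m * u * v) - r * g * h) =
      r * (G' ^+ 2 - G ^+ 2) * z' ^+ 2.
    have -> : 4 * s * (alpha * (m * u * v) - r * g * h) =
      (alpha * m) * (4 * s * (u * v)) - r * (4 * s * (g * h)) by ring.
    by rewrite alphaE uvE ghE; ring.
  apply: (@le_trans _ _ (Cd * T%:R ^- 2)); last first.
    by rewrite ler_wpM2r// ?invr_ge0 ?exprn_ge0//; lra.
  rewrite -(ler_pM2l s4) -[X in X * _]gtr0_norm// -normrM diffE normrM normrX.
  rewrite [leRHS]mulrA (_ : 4 * s * Cd = `|r * (G' ^+ 2 - G ^+ 2)|); last first.
    by rewrite mulrC divfK// gt_eqF.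
  by rewrite ler_wpM2l// -exprVn lerXn2r ?nnegrE ?invr_ge0.
Qed.

(* With w = beta z^2 and y = beta^(h+1) z^(2h+1) one has
   y^2 = beta w^(2h+1), so both w^(2h+1) - w'^(2h+1) and y^2 - y'^2 split into
   integer factors of nearly equal size. *)
Lemma quadratic_factored_approx {R : realType} (s alpha k B B' : R) (j : nat) :
  0 < s -> s ^+ 2 \is a Num.int -> irrational s ->
  k \is a Num.int -> k != 0 -> B != 0 ->
  conjugates s B B' -> alpha * k = B ->
  exists (h : nat) (C : R) (T0 : nat), [/\ (j <= h)%N, 1 <= C &
    forall T, (T0 <= T)%N -> (1 <= T)%N ->
      factored_approx alpha C h.+1.*2 h.*2.+1.*2 T].
Proof.
move=> s0 s2 s_irr ki k0 B0 BB' alphaE.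
have [C0 C01 small] := small_conjugate s0 s2 s_irr.
have [h [Cp [jh Cp1 split_h]]] := balanced_splitting (R := R) j.
have Bn0 : 0 < `|B| by rewrite normr_gt0.
have [T0 [T02 domT]] := exists_nat_dominating `|B'| Bn0.
have [T0' [_ domT']] := exists_nat_dominating 1 Bn0.
pose n := h.*2.+1.
pose c1 := 1 + s^-1; have c11 : 1 <= c1 by rewrite lerDl invr_ge0 ltW.
(* [Cs] bounds the four factors, through |w| <= U and |y| <= U^(h+1) with U = |B| C0^2 T^2; [Cd] is
   the coefficient of the error after w' is bounded by |B'| / T^2. *)
pose Cs := (2 + `|k|) * c1 * Cp * (`|B| * C0 ^+ 2) ^+ h.+1.
pose Cd := `|B' - B| * `|B'| ^+ n / (2 * s).
have c10 : 0 <= c1 by lra.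
have Cp0 : 0 <= Cp by lra.
have C00 : 0 <= C0 by lra.
have ss : 0 < 2 * s by lra.
have Cd0 : 0 <= Cd by rewrite divr_ge0 ?mulr_ge0 ?exprn_ge0// ltW.
have BC0 : 0 <= `|B| * C0 ^+ 2 by rewrite mulr_ge0 ?exprn_ge0//; lra.
have k2 : 1 <= 2 + `|k| by have := normr_ge0 k; lra.
have kk2 : `|k| <= 2 + `|k| by rewrite lerDr.
have k20 : 0 <= 2 + `|k| by lra.
have Cs0 : 0 <= Cs by rewrite !mulr_ge0 ?exprn_ge0//; lra.
have CsC : Cs <= 1 + Cs + Cd by lra.
have CdC : Cd <= 1 + Cs + Cd by lra.
exists h, (1 + Cs + Cd), (maxn T0 T0'); split=> [//||T]; first by lra.
rewrite geq_max => /andP[TT0 TT0'] T1.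
have T2 : 2 <= T%:R :> R by rewrite (ler_nat R 2) (leq_trans T02).
have {}domT := domT T TT0; have {}domT' := domT' T TT0'.
have [z [z' [zz' z'T Tz zT]]] := small T T1.
have T_gt0 : 0 < T%:R :> R by lra.
have TV1 : T%:R^-1 < 1 :> R by rewrite invf_lt1; lra.
have z'1 : `|z'| <= 1 by lra.
have z1 : 1 <= `|z| by lra.
have Bz : `|B'| < `|B| * `|z|.
  by apply: (lt_le_trans domT); rewrite ler_wpM2l.
have B'z' : `|B'| * `|z'| < `|B|.
  apply: (@le_lt_trans _ _ (`|B'| * T%:R^-1)); first by rewrite ler_wpM2l.
  by rewrite ltr_pdivrMr.
pose w := B * z ^+ 2; pose w' := B' * z' ^+ 2.
have ww' : conjugates s w w' by apply: conjugatesM => //; exact: conjugatesX.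
have w1 : 1 <= `|w|.
  rewrite /w normrM normrX expr2 mulrA -[leLHS]mulr1 ler_pM//.
  by apply: (le_trans (ltW domT')); rewrite ler_wpM2l.
pose U := (`|B| * C0 ^+ 2) * T%:R ^+ 2.
have wU : `|w| <= U.
  rewrite /w /U normrM normrX -mulrA -exprMn ler_wpM2l// lerXn2r ?nnegrE//.
  by rewrite mulr_ge0//; lra.
have w'w : `|w'| < `|w|.
  rewrite /w /w' !(normrX, normrM); apply: (@le_lt_trans _ _ `|B'|).
    by rewrite -[leRHS]mulr1 ler_wpM2l// exprn_ile1.
  by apply: (lt_le_trans Bz); rewrite expr2 mulrA ler_peMr// mulr_ge0.
(* With this grouping |y'| < |y| follows factor by factor from |B'z'| < |Bz| and |z'| <= 1 <=
   |z|. *)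
pose y := (B * z) ^+ h.+1 * z ^+ h; pose y' := (B' * z') ^+ h.+1 * z' ^+ h.
have yy' : conjugates s y y'.
  apply: conjugatesM => //; last exact: conjugatesX.
  by apply: conjugatesX => //; exact: conjugatesM.
have norm_y (a b : R) : `|a ^+ h.+1 * b ^+ h| = `|a| ^+ h.+1 * `|b| ^+ h.
  by rewrite normrM !normrX.
have y'y : `|y'| < `|y|.
  rewrite /y /y' !norm_y; apply: (@le_lt_trans _ _ (`|B' * z'| ^+ h.+1)).
    by rewrite -[leRHS]mulr1 ler_wpM2l ?exprn_ge0// exprn_ile1.
  apply: (@lt_le_trans _ _ (`|B * z| ^+ h.+1)).
    rewrite ltrXn2r// !normrM; apply: (lt_le_trans B'z').
    by rewrite ler_peMr.
  by rewrite ler_peMr ?exprn_ge0// exprn_ege1.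
have yU : `|y| <= U ^+ h.+1.
  have -> : U ^+ h.+1 = (`|B| * (C0 * T%:R)) ^+ h.+1 * (C0 * T%:R) ^+ h.+1.
    by rewrite -exprMn /U; congr (_ ^+ _); ring.
  rewrite /y norm_y; apply: ler_pM; rewrite ?exprn_ge0//.
    by rewrite lerXn2r ?nnegrE// ?normrM ?mulr_ge0// ler_wpM2l.
  rewrite exprS; apply: (@le_trans _ _ (1 * `|z| ^+ h)); first by rewrite mul1r.
  apply: ler_pM; rewrite ?exprn_ge0//; first exact: le_trans zT.
  by rewrite lerXn2r ?nnegrE ?mulr_ge0.
have nE : n = (h.+1 + h)%N by rewrite /n -addnn addSn.
have sqrE (a b : R) :
    ((a * b) ^+ h.+1 * b ^+ h) ^+ 2 = a * (a * b ^+ 2) ^+ n.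
  by rewrite nE exprD !expr2 !exprMn !exprS; ring.
have yE : y ^+ 2 = B * w ^+ n by exact: sqrE.
have y'E : y' ^+ 2 = B' * w' ^+ n by exact: sqrE.
have [_ [w2 [_ w2i _ w2E [_ _ w2w]]]] := conjugates_coords s0 ww' w'w.
have [y1 [y2 [y1i y2i y12E _ [y120 y1y y2y]]]] := conjugates_coords s0 yy' y'y.
have [P [Q [Pi Qi PQE PC QC]]] := split_h s w w' s2 ww' (ltW w'w).
rewrite -/c1 in w2w y1y y2y.
(* The terms in w^n cancel, leaving a multiple of w'^n of size T^(-2n). *)
have diffE : 2 * s * (alpha * (k * w2 * P * Q) - 2 * y1 * y2) =
    (B' - B) * w' ^+ n.
  have -> : 2 * s * (alpha * (k * w2 * P * Q) - 2 * y1 * y2) =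
      (alpha * k) * (2 * s * w2 * (P * Q)) - 4 * s * (y1 * y2) by ring.
  by rewrite y12E w2E alphaE -PQE yE y'E; ring.
have abE : 2 * s * (w2 * (P * Q)) = w ^+ n - w' ^+ n.
  by rewrite mulrA w2E PQE.
have U0 : 0 <= U by rewrite mulr_ge0 ?exprn_ge0//; lra.
have U1 : 1 <= U by exact: le_trans wU.
have Uh : 0 <= U ^+ h by rewrite exprn_ge0.
have Uh1 : 0 <= U ^+ h.+1 by rewrite exprn_ge0.
have UhS : U ^+ h <= U ^+ h.+1 by rewrite exprS ler_peMl.
have wUh : `|w| ^+ h <= U ^+ h by rewrite lerXn2r ?nnegrE.
have CsT : (2 + `|k|) * c1 * Cp * U ^+ h.+1 <=
    (1 + Cs + Cd) * T%:R ^+ h.+1.*2.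
  have -> : (2 + `|k|) * c1 * Cp * U ^+ h.+1 = Cs * T%:R ^+ h.+1.*2.
    by rewrite /Cs /U exprMn -exprM mul2n mulrA.
  by rewrite ler_wpM2r ?exprn_ge0.
have size_le (x t : R) : 0 <= x -> x <= (2 + `|k|) * c1 * Cp ->
    t <= x * U ^+ h.+1 -> t <= (1 + Cs + Cd) * T%:R ^+ h.+1.*2.
  move=> x0 xC tx; apply: le_trans CsT; apply: (le_trans tx).
  by rewrite ler_wpM2r.
exists (k * w2 * P), Q, (2 * y1), y2; split.
- by rewrite !rpredM ?(natr_int R 2).
- suff wPQ : w2 * (P * Q) != 0 by rewrite -!mulrA mulf_neq0.
  apply: contraTneq w'w => wPQ0; rewrite -leNgt.
  rewrite -(@ler_pXn2r _ n) ?nnegrE// -!normrX.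
  by move/eqP: abE; rewrite wPQ0 mulr0 eq_sym subr_eq0 => /eqP ->.
- by rewrite -mulrA mulf_neq0.
- split.
  (* The extra factor [w2], of size O(U), is put with [P], of size O(U^h), so that the total stays
     O(U^(h+1)). *)
  + apply: (size_le (`|k| * c1 * Cp)); first by rewrite !mulr_ge0.
      by rewrite !ler_wpM2r.
    rewrite !normrM -!mulrA ler_wpM2l// exprS.
    rewrite (_ : c1 * (Cp * (U * U ^+ h)) = (c1 * U) * (Cp * U ^+ h));
      last by ring.
    rewrite ler_pM//; first by apply: (le_trans w2w); rewrite ler_wpM2l.
    by apply: (le_trans PC); rewrite ler_wpM2l.
  + apply: (size_le Cp) => //.
      by rewrite -[leLHS]mul1r ler_wpM2r// mulr_ege1.
    by apply: (le_trans QC); rewrite ler_wpM2l// (le_trans wUh).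
  + apply: (size_le (2 * c1)); first by rewrite mulr_ge0.
      by rewrite -[leLHS]mulr1 ler_pM ?mulr_ge0// ler_wpM2r// lerDl.
    rewrite normrM ger0_norm// -mulrA ler_wpM2l//.
    by apply: (le_trans y1y); rewrite ler_wpM2l.
  + apply: (size_le c1) => //.
      by rewrite -[leLHS]mulr1 ler_pM// -[leLHS]mul1r ler_wpM2r.
    by apply: (le_trans y2y); rewrite ler_wpM2l.
- apply: (@le_trans _ _ (Cd * T%:R ^- h.*2.+1.*2)); last first.
    by rewrite ler_wpM2r// ?invr_ge0 ?exprn_ge0.
  rewrite -(ler_pM2l ss) -[X in X * _]gtr0_norm// -normrM diffE normrM normrX.
  rewrite [leRHS]mulrA (_ : 2 * s * Cd = `|B' - B| * `|B'| ^+ n); last first.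
    by rewrite mulrC divfK// gt_eqF.
  rewrite -mulrA ler_wpM2l// -/n -mul2n exprM -exprVn -exprMn.
  rewrite lerXn2r ?nnegrE ?mulr_ge0 ?invr_ge0 ?exprn_ge0//.
  rewrite /w' normrM normrX ler_wpM2l// -exprVn.
  by rewrite lerXn2r ?nnegrE ?invr_ge0.
Qed.

(** * Choice of h and conclusion *)

Lemma infinite_set_ge2 : infinite_set [set N : nat | (2 <= N)%N].
Proof.
move=> fin; apply: infinite_nat.
apply: (@sub_finite_set _ _ (`I_2 `|` [set N | (2 <= N)%N])).
  by move=> N _; case: (ltnP N 2); [left|right].
by rewrite finite_setU.
Qed.

Theorem theorem1p2 (R : realType) (D : nat) (alpha : R) (lam : nat -> R)
    (D_gt1 : (1 < D)%N) (D_sqfree : squarefree D)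
    (alpha_K : quad_field D alpha) (alpha_irr : irrational alpha)
    (alpha_gt0 : 0 < alpha)
    (lamE : enumerates_spectrum alpha lam) :
  (forall eps : R, 0 < eps ->
     exists C : R, 0 < C /\
       infinite_set [set N : nat | (2 <= N)%N /\
                       min_gap lam N <= C * N%:R `^ (-1 + eps)])
  /\
  ((exists (r : rat) (gamma : R),
      [/\ 0 < r, quad_field D gamma, gamma != 0 &
          alpha = ratr r * gamma ^+ 2]) ->
   exists C : R, 0 < C /\
     forall N : nat, (2 <= N)%N -> min_gap lam N <= C * N%:R^-1).
Proof.
have alpha_n0 : alpha != 0 by rewrite gt_eqF.
set s : R := Num.sqrt D%:R in alpha_K *.
have D0 : 0 <= D%:R :> R by [].
have s_gt0 : 0 < s by rewrite sqrtr_gt0 ltr0n ltnW.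
have s2_int : s ^+ 2 \is a Num.int by rewrite sqr_sqrtr// natr_int.
have s_irr := sqrt_irrational_of_quad_field alpha_K alpha_irr.
split=> [eps eps0|].
  have [k [B' [ki k0 BB']]] := quad_field_conjugates alpha_K.
  have k_n0 : k != 0 by rewrite gt_eqF.
  have B0 : k * alpha != 0 by rewrite mulf_neq0.
  have [h [C [T0 [jh C1 approx]]]] :=
    quadratic_factored_approx (Num.truncn eps^-1) s_gt0 s2_int s_irr ki k_n0 B0
      BB' (mulrC _ _).
  have [C' [C'0 gapC']] := min_gap_powR alpha_gt0 alpha_irr lamE
    (ltn0Sn h.*2.+1 : (0 < h.+1.*2)%N) C1 approx.
  (* The bound holds for every N >= 2. The exponent obtained is -1 + 1/(2h + 2), and h >=
     floor(1/eps) makes 1/(2h + 2) <= eps. *)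
  exists C'; split=> //; apply: sub_infinite_set infinite_set_ge2 => N N2.
  split=> //; apply: (le_trans (gapC' N N2)).
  rewrite ler_pM2l//; apply: ler_powR.
    by rewrite (ler_nat R 1) ltnW.
  have h0 : 0 < h.+1.*2%:R :> R by rewrite ltr0n.
  have eh : eps^-1 <= h.+1.*2%:R.
    apply: (@le_trans _ _ h.+1%:R).
      by rewrite ltW// (lt_le_trans (truncnS_gt _))// ler_nat ltnS.
    by rewrite ler_nat -addnn leq_addr.
  rewrite lerNl opprD opprK ler_pdivlMr; last by rewrite ltr0n double_gt0.
  have eh1 : 1 <= eps * h.+1.*2%:R by rewrite -ler_pdivrMl// mulr1.
  have -> : h.*2.+1.*2%:R = 2 * h.+1.*2%:R - 2 :> R.
    by rewrite -!muln2 !natrM -!natr1 natrM; ring.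
  have -> : h.+1.*2.*2%:R = 2 * h.+1.*2%:R :> R by rewrite -mul2n natrM.
  by lra.
move=> [r [gamma [r0 gamma_K gamma0 alphaE]]].
have [k [G' [ki k0 GG']]] := quad_field_conjugates gamma_K.
have k_n0 : k != 0 by rewrite gt_eqF.
have G0 : k * gamma != 0 by rewrite mulf_neq0.
have dr0 : (denq r)%:~R != 0 :> R by rewrite intr_eq0 denq_neq0.
have nr0 : (numq r)%:~R != 0 :> R by rewrite intr_eq0 numq_eq0 gt_eqF.
(* Multiplying alpha = r gamma^2 by [denq r] times k^2 makes it integral; e = 1 and f = 2 then give
   the exponent -1. *)
have mi : (denq r)%:~R * k ^+ 2 \is a Num.int.
  by rewrite rpredM ?rpredX ?intr_int.
have m0 : (denq r)%:~R * k ^+ 2 != 0 by rewrite mulf_neq0 ?expf_neq0.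
have E : alpha * ((denq r)%:~R * k ^+ 2) = (numq r)%:~R * (k * gamma) ^+ 2.
  by rewrite alphaE -ratr_numq_denq; ring.
have [C [T0 [C1 approx]]] := square_class_factored_approx s_gt0 s2_int s_irr mi
  (intr_int _ _) m0 nr0 G0 GG' E.
have [C' [C'0 gapC']] :=
  min_gap_powR alpha_gt0 alpha_irr lamE (ltn0Sn 0) C1 approx.
exists C'; split=> // N N2; have := gapC' N N2.
by rewrite divff ?pnatr_eq0// -powR_inv1.
Qed.
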